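(* Let $X$ be a non-zero real vector space and let $S$ be a skeleton in $X$ with $e$ as its head, for some $e \in X$ with $e \neq 0$. Let $V$ be the linear span of $S$ and let $V^+$ be the cone generated by $S$ (all finite linear combinations of elements of $S$ with non-negative coefficients). Then $(V, V^+, e)$ is an order unit space, and $$S_0 := S \setminus \{0, e\} = \{ v \in V^+ : \Vert v \Vert = \Vert e - v \Vert = 1 \},$$ where $\Vert\cdot\Vert$ is the order unit norm on $V$.
   Context: Notation: $\mathbb{R}^+ = [0,\infty)$. Skeleton: Let $X$ be a non-zero real vector space and let $S \subset X$ contain $0$ and some $e \neq 0$. Put $S_0 = S \setminus \{0, e\}$. $S$ is a skeleton with $e$ as its head if: (1) if $u \in S$, then $e - u \in S$; (2) if $u, v \in S$ and $\lambda \in [0,1]$, then there exist $w \in S_0$ and $\alpha, \beta \in \mathbb{R}^+$ such that $\lambda u + (1-\lambda) v = \alpha e + \beta w$; (3) if $e = \sum_{i=1}^n \alpha_i u_i$ for some $u_1, \dots, u_n \in S_0$ and $\alpha_1, \dots, \alpha_n > 0$ with $n \ge 2$, then $\sum_{i \neq j} \alpha_i \ge 1$ for all $j = 1, \dots, n$. Order unit space: a real vector space $V$ with a cone $V^+$ and $e \in V^+$ such that $V^+$ is proper ($V^+ \cap (-V^+) = \{0\}$), $e$ is an order unit (for each $v \in V$ there is $k > 0$ with $ke \pm v \in V^+$), and $V^+$ is Archimedean (if $v\in V$ and $ke + v \in V^+$ for all $k > 0$, then $v \in V^+$). The order unit norm is $\Vert v \Vert = \inf\{k > 0 : ke \pm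 v \in V^+\}$. *)

(* Defs.v *)
From mathcomp Require Import all_boot all_order all_algebra.
From mathcomp Require Import classical_sets reals.

Set Implicit Arguments.
Unset Strict Implicit.
Unset Printing Implicit Defensive.

Import Order.TTheory GRing.Theory Num.Theory.

Local Open Scope classical_set_scope.
Local Open Scope ring_scope.

Definition skeleton_body {X : zmodType} (S : set X) (e : X) : set X :=
  S `\` [set 0; e].

(* The vectors u i in skeleton_sum need not be distinct. *)
Record skeleton {R : realType} {X : lmodType R} (S : set X) (e : X) : Prop := {
  skeleton_head_neq0 : e <> 0;
  skeleton_0 : S 0;
  skeleton_head : S e;
  skeleton_compl : forall u : X, S u -> S (e - u);
  skeleton_segment : forall (u v : X) (l : R),
    S u -> S v -> 0 <= l <= 1 ->
    exists (w : X) (a b : R),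
      [/\ skeleton_body S e w, 0 <= a, 0 <= b & l *: u + (1 - l) *: v = a *: e + b *: w];
  skeleton_sum : forall (n : nat) (u : 'I_n -> X) (a : 'I_n -> R),
    (2 <= n)%N ->
    (forall i, skeleton_body S e (u i)) ->
    (forall i, 0 < a i) ->
    e = \sum_(i < n) a i *: u i ->
    forall j : 'I_n, 1 <= \sum_(i < n | i != j) a i
}.

Definition linear_span {R : realType} {X : lmodType R} (S : set X) : set X :=
  [set v | exists (n : nat) (a : 'I_n -> R) (u : 'I_n -> X),
     (forall i, S (u i)) /\ v = \sum_(i < n) a i *: u i].

Definition generated_cone {R : realType} {X : lmodType R} (S : set X) : set X :=
  [set v | exists (n : nat) (a : 'I_n -> R) (u : 'I_n -> X),
     [/\ forall i, 0 <= a i, forall i, S (u i) & v = \sum_(i < n) a i *: u i]].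

Definition is_cone {R : realType} {X : lmodType R} (C : set X) : Prop :=
  [/\ C !=set0,
      forall u v : X, C u -> C v -> C (u + v)
    & forall (k : R) (v : X), 0 <= k -> C v -> C (k *: v)].

(* The vector space V is given as a linear subspace of an ambient space X, and
   quantification over vectors is relativised to V. *)
Record order_unit_space {R : realType} {X : lmodType R}
    (V Vp : set X) (e : X) : Prop := {
  ous_subspace : submod_closed (mem V);
  ous_cone_sub : Vp `<=` V;
  ous_cone : is_cone Vp;
  ous_unit_pos : Vp e;
  ous_proper : Vp `&` [set v | Vp (- v)] = [set 0];
  ous_unit : forall v : X, V v ->
    exists2 k : R, 0 < k & Vp (k *: e + v) /\ Vp (k *: e - v);
  ous_archimedean : forall v : X, V v ->
    (forall k : R, 0 < k -> Vp (k *: e + v)) -> Vp v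
}.

(* The set under inf is non-empty when v lies in an order unit space with cone
   Vp and unit e; for other v, inf may take its default value. *)
Definition order_unit_norm {R : realType} {X : lmodType R}
    (Vp : set X) (e v : X) : R :=
  inf [set k : R | [/\ 0 < k, Vp (k *: e + v) & Vp (k *: e - v)]].

(* Main.v *)
Require Import Defs.
From mathcomp Require Import all_boot all_order all_algebra.
From mathcomp Require Import classical_sets reals.
From mathcomp Require Import lra.

Import Order.TTheory GRing.Theory Num.Theory.

Local Open Scope classical_set_scope.
Local Open Scope ring_scope.

(** Write [S0] for the body of the skeleton.  By the segment axiom the sum of
    two non-negative multiples of body vectors is again of the form
    [a e + b w] with [a, b >= 0] and [w] in [S0], so the cone generated by [S]
    consists exactly of these vectors ([generated_coneE]); as
    [- w = (e - w) - e] and [e - w] lies in [S0], the span consists of the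
    vectors [c e + b w] with [c] any real and [b >= 0] ([linear_spanE]).

    Everything else follows from one rigidity fact: [c e + b w] with
    [b >= 0] and [w] in [S0] belongs to the cone only if [c >= 0]
    ([cone_coef_ge0]).  Indeed, if [c e + b w = a' e + b' w'] then adding
    [b' (e - w')] to both sides gives
    [(a' + b' - c) e = b w + b' (e - w')], and the third axiom, rescaled, says
    that a positive multiple [k e] written with two body vectors needs both
    coefficients at least [k] ([head_coef_ge]); for [c < 0] this would force
    [a' + b' - c <= b'].

    Properness and the Archimedean property are then comparisons of
    coefficients of [e].  For the norm, [v = a e + b w] in the cone satisfies
    [k e - v = (k - a - b) e + b (e - w)], so the norm of [v] is [a + b]
    ([order_unit_norm_cone]).  If it equals 1, then [e - v = b (e - w)] has
    norm [b]; if that is 1 too, then [a = 0] and [v = w]. *)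

Section Skeleton.

Context {R : realType} {X : lmodType R} {S : set X} {e : X} (hS : skeleton S e).

Local Notation S0 := (skeleton_body S e).

(** * Writing multiples of the head with body vectors *)

Lemma body_compl w : S0 w -> S0 (e - w).
Proof.
move=> [Sw nw]; split; first exact: (skeleton_compl hS).
move=> [/eqP|/eqP]; rewrite ?subr_eq0 => /eqP h; apply: nw; first by right.
by left; apply: oppr_inj; rewrite oppr0 -(addKr e (- w)) h addNr.
Qed.

Lemma body_nonempty : exists w, S0 w.
Proof.
have l01 : 0 <= (0 : R) <= 1 by rewrite lexx ler01.
by have [w [a [b [Sw _ _ _]]]] :=
  skeleton_segment hS (skeleton_0 hS) (skeleton_0 hS) l01; exists w.
Qed.

Lemma head_pos_coef_ge1 a b p q : S0 p -> S0 q -> 0 < a -> 0 < b ->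
  e = a *: p + b *: q -> 1 <= a /\ 1 <= b.
Proof.
move=> Sp Sq a0 b0 eE.
pose u (i : 'I_2) := if i == 0 then p else q.
pose c (i : 'I_2) := if i == 0 then a else b.
have Su i : S0 (u i) by rewrite /u; case: ifP.
have c0 i : 0 < c i by rewrite /c; case: ifP.
have eE' : e = \sum_(i < 2) c i *: u i by rewrite !big_ord_recl big_ord0 addr0.
have H := skeleton_sum hS (isT : 2 <= 2)%N Su c0 eE'.
split; [have := H 1 | have := H 0];
  by rewrite big_mkcond !big_ord_recl big_ord0 /= !addr0 ?add0r.
Qed.

(** Splitting [c p] as [(c / 2) p + (c / 2) p] forces [c >= 2], which makes the
    split [(1 / 2) p + (c - 1 / 2) p] available; its first coefficient is too
    small. *)
Lemma head_neq_scale_body c p : S0 p -> 0 < c -> e <> c *: p.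
Proof.
move=> Sp c0 eE.
have split_c t : 0 < t -> t < c -> 1 <= t.
  move=> t0 tc; have /head_pos_coef_ge1 [] // : e = t *: p + (c - t) *: p.
    by rewrite -scalerDl subrKC.
  by rewrite subr_gt0.
have c2 : 1 <= c / 2 by apply: split_c; lra.
suff : 1 <= (2^-1 : R) by lra.
by apply: split_c; lra.
Qed.

(** Allowing [a] or [b] to vanish is harmless: [e] would then be a positive
    multiple of a single body vector, which [head_neq_scale_body] excludes. *)
Lemma head_coef_ge k a b p q : S0 p -> S0 q -> 0 < k -> 0 <= a -> 0 <= b ->
  k *: e = a *: p + b *: q -> k <= a /\ k <= b.
Proof.
move=> Sp Sq k0 a0 b0 kE.
have eE : e = (k^-1 * a) *: p + (k^-1 * b) *: q.
  by rewrite -!scalerA -scalerDr -kE scalerK ?gt_eqF.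
have [a0' | a0'] := eqVneq a 0; last have [b0' | b0'] := eqVneq b 0.
- have [b0' | b0'] := eqVneq b 0.
    by case: (skeleton_head_neq0 hS); rewrite eE a0' b0' !mulr0 !scale0r addr0.
  case: (head_neq_scale_body (k^-1 * b) q) => //.
    by rewrite mulr_gt0 ?invr_gt0 // lt_def b0'.
  by rewrite {1}eE a0' mulr0 scale0r add0r.
- case: (head_neq_scale_body (k^-1 * a) p) => //.
    by rewrite mulr_gt0 ?invr_gt0 // lt_def a0'.
  by rewrite {1}eE b0' mulr0 scale0r addr0.
have [] := head_pos_coef_ge1 _ _ _ _ Sp Sq _ _ eE.
- by rewrite mulr_gt0 ?invr_gt0 // lt_def a0'.
- by rewrite mulr_gt0 ?invr_gt0 // lt_def b0'.
- by rewrite !(mulrC k^-1) !ler_pdivlMr // !mul1r.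
Qed.

(** * Normal forms for the cone and the span *)

(** One normal form serves both the cone, where [C] is the half-line of
    non-negative reals, and the span, where [C] is the whole line. *)
Definition head_body (C : set R) : set X :=
  [set v | exists c b w, [/\ C c, 0 <= b, S0 w & v = c *: e + b *: w]].

(** Dividing by [b1 + b2] turns the sum into a point of the segment from [w2]
    to [w1]. *)
Lemma body_add w1 w2 b1 b2 : S0 w1 -> S0 w2 -> 0 <= b1 -> 0 <= b2 ->
  exists a b w, [/\ 0 <= a, 0 <= b, S0 w & b1 *: w1 + b2 *: w2 = a *: e + b *: w].
Proof.
move=> Sw1 Sw2 b10 b20.
have [s0 | s0] := eqVneq (b1 + b2) 0.
  have -> : b1 = 0 by lra.
  have -> : b2 = 0 by lra.
  by exists 0, 0, w1; rewrite !scale0r.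
have sp : 0 < b1 + b2 by rewrite lt_def s0 addr_ge0.
have lP : 0 <= b1 / (b1 + b2) <= 1.
  by rewrite divr_ge0 ?(ltW sp) // ler_pdivrMr // mul1r lerDl.
have [w [a [b [Sw a0 b0 E]]]] :=
  skeleton_segment hS (proj1 Sw1) (proj1 Sw2) lP.
exists ((b1 + b2) * a), ((b1 + b2) * b), w.
split; rewrite ?mulr_ge0 ?(ltW sp) //.
rewrite -!scalerA -scalerDr -E scalerDr !scalerA mulrBr mulr1.
by rewrite mulrCA mulfV // mulr1 addrAC subrr add0r.
Qed.

Lemma head_body_add C : (forall c d, C c -> C d -> C (c + d)) ->
  (forall c, 0 <= c -> C c) ->
  forall u v, head_body C u -> head_body C v -> head_body C (u + v).
Proof.
move=> CD C0 u v [c1 [b1 [w1 [Cc1 b10 Sw1 ->]]]] [c2 [b2 [w2 [Cc2 b20 Sw2 ->]]]].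
have [a [b [w [a0 b0 Sw E]]]] := body_add _ _ _ _ Sw1 Sw2 b10 b20.
exists (c1 + c2 + a), b, w; split => //; first exact: CD (CD _ _ _ _) (C0 _ _).
by rewrite addrACA E !scalerDl !addrA.
Qed.

Lemma head_body_scale C k v : (forall c, C c -> C (k * c)) -> 0 <= k ->
  head_body C v -> head_body C (k *: v).
Proof.
move=> Ck k0 [c [b [w [Cc b0 Sw ->]]]]; exists (k * c), (k * b), w.
by split; rewrite ?mulr_ge0 //; [exact: Ck | rewrite scalerDr !scalerA].
Qed.

Lemma head_body_skeleton C u : (forall c, 0 <= c -> C c) -> S u -> head_body C u.
Proof.
move=> C0 Su; have [w Sw] := body_nonempty.
have [u0 | u0] := eqVneq u 0.
  by exists 0, 0, w; split; rewrite ?scale0r ?addr0 //; exact: C0.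
have [ue | ue] := eqVneq u e.
  exists 1, 0, w; split; rewrite ?scale0r ?addr0 ?scale1r //; exact: C0.
exists 0, 1, u; split; rewrite ?scale0r ?add0r ?scale1r //; first exact: C0.
by split => // -[/eqP|/eqP]; [rewrite (negPf u0) | rewrite (negPf ue)].
Qed.

Lemma generated_coneE : generated_cone S = head_body [set c | 0 <= c].
Proof.
apply/seteqP; split => [v [n [a [u [a0 Su ->]]]] | v [c [b [w [c0 b0 Sw ->]]]]].
  apply: big_ind => [||i _].
  - exact: head_body_skeleton (skeleton_0 hS).
  - by apply: head_body_add => // c d; exact: addr_ge0.
  - apply: head_body_scale => // [c|]; first exact: mulr_ge0.
    exact: head_body_skeleton.
exists 2, (fun i => if i == 0 then c else b), (fun i => if i == 0 then e else w).
split=> [i|i|]; [by case: ifP | | by rewrite !big_ord_recl big_ord0 addr0].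
by case: ifP => _; [exact: skeleton_head hS | exact: proj1 Sw].
Qed.

Lemma head_bodyT_opp v : head_body setT v -> head_body setT (- v).
Proof.
move=> [c [b [w [_ b0 Sw ->]]]].
exists (- c - b), b, (e - w); split => //; first exact: body_compl.
by rewrite scalerBl scalerBr scaleNr opprD addrA subrK.
Qed.

Lemma linear_spanE : linear_span S = head_body setT.
Proof.
apply/seteqP; split => [v [n [a [u [Su ->]]]] | v [c [b [w [_ b0 Sw ->]]]]].
  apply: big_ind => [||i _].
  - exact: head_body_skeleton (skeleton_0 hS).
  - by apply: head_body_add.
  - have Hu : head_body setT (u i) by exact: head_body_skeleton.
    have [a0 | a0] := leP 0 (a i); first exact: head_body_scale.
    rewrite -[a i]opprK scaleNr; apply: head_bodyT_opp.
    by apply: head_body_scale => //; rewrite oppr_ge0 ltW.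
exists 2, (fun i => if i == 0 then c else b), (fun i => if i == 0 then e else w).
split=> [i|]; last by rewrite !big_ord_recl big_ord0 addr0.
by case: ifP => _; [exact: skeleton_head hS | exact: proj1 Sw].
Qed.

Lemma cone_head_body c b w : 0 <= c -> 0 <= b -> S0 w ->
  generated_cone S (c *: e + b *: w).
Proof. by move=> c0 b0 Sw; rewrite generated_coneE; exists c, b, w. Qed.

Lemma cone_add u v :
  generated_cone S u -> generated_cone S v -> generated_cone S (u + v).
Proof.
by rewrite generated_coneE; apply: head_body_add => // c d; exact: addr_ge0.
Qed.

Lemma cone_scale k v :
  0 <= k -> generated_cone S v -> generated_cone S (k *: v).
Proof.
move=> k0; rewrite generated_coneE.
by apply: head_body_scale => // c; exact: mulr_ge0.
Qed.

(** * The order unit structure and its norm *)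

(** Complementing [w'] moves it to the side of [w], which turns membership in
    the cone into an expression of a multiple of [e] by two body vectors. *)
Lemma cone_coef_ge0 c b w : 0 <= b -> S0 w ->
  generated_cone S (c *: e + b *: w) -> 0 <= c.
Proof.
move=> b0 Sw; rewrite generated_coneE => -[a' [b' [w' [/= a0' b0' Sw' E]]]].
rewrite leNgt; apply/negP => c0.
have kE : (a' + b' - c) *: e = b *: w + b' *: (e - w').
  have -> : b *: w = a' *: e + b' *: w' - c *: e by rewrite -E addrC addKr.
  by rewrite !scalerDl scalerBr scaleNr [RHS]addrAC
    [X in _ = X - _]addrACA subrr addr0.
have [|_] := head_coef_ge _ _ _ _ _ Sw (body_compl _ Sw') _ b0 b0' kE; lra.
Qed.

Lemma head_sub_cone k a b w : k *: e - (a *: e + b *: w)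
  = (k - (a + b)) *: e + b *: (e - w).
Proof.
by rewrite scalerBl scalerDl scalerBr !opprD !addrA subrK.
Qed.

(** By [head_sub_cone] and [cone_coef_ge0], the positive [k] with [k e - v] in
    the cone are those with [k >= a + b], and [k e + v] is always in it. *)
Lemma order_unit_norm_cone a b w : 0 <= a -> 0 <= b -> S0 w ->
  order_unit_norm (generated_cone S) e (a *: e + b *: w) = a + b.
Proof.
move=> a0 b0 Sw; rewrite /order_unit_norm.
set K := [set k | _].
have KP k : K k <-> 0 < k /\ a + b <= k.
  rewrite /K /= head_sub_cone; split => [[k0 _] | [k0 kab]].
    move=> /(cone_coef_ge0 _ _ _ b0 (body_compl _ Sw)).
    by rewrite subr_ge0.
  split=> //; last by apply: cone_head_body => //;
    [rewrite subr_ge0 | exact: body_compl].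
  by rewrite addrA -scalerDl; apply: cone_head_body; rewrite ?addr_ge0 ?(ltW k0).
have abK : lbound K (a + b) by move=> k /KP[].
(* The infimum need not be attained, as [a + b] may vanish. *)
apply/eqP; rewrite eq_le; apply/andP; split.
  apply/ler_addgt0Pr => d d0; apply: ge_inf; first by exists (a + b).
  by apply/KP; split; [rewrite ltr_wpDl ?addr_ge0 | rewrite lerDl ltW].
by apply: lb_le_inf => //; exists (a + b + 1); apply/KP; split; lra.
Qed.

Lemma order_unit_space_skeleton :
  order_unit_space (linear_span S) (generated_cone S) e.
Proof.
have [w0 Sw0] := body_nonempty.
have coneE : generated_cone S e.
  by have := cone_head_body 1 0 _ ler01 (lexx 0) Sw0;
    rewrite scale1r scale0r addr0.
have cone0 : generated_cone S 0.
  by rewrite -(scale0r e); exact: cone_scale.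
split.
- rewrite linear_spanE; split=> [|k u v]; rewrite !inE.
    exact: head_body_skeleton (skeleton_0 hS).
  move=> Hu Hv; apply: head_body_add => //.
  have [k0 | k0] := leP 0 k; first exact: head_body_scale.
  rewrite -[k]opprK scaleNr; apply: head_bodyT_opp.
  by apply: head_body_scale => //; rewrite oppr_ge0 ltW.
- rewrite linear_spanE generated_coneE => v [c [b [w [_ b0 Sw ->]]]].
  by exists c, b, w.
- split; [by exists 0 | exact: cone_add | exact: cone_scale].
- exact: coneE.
- apply/seteqP; split=> [v [] | v ->]; last by split; rewrite /= ?oppr0.
  rewrite {1}generated_coneE => -[a [b [w [/= a0 b0 Sw ->]]]].
  rewrite -[- _]add0r -(scale0r e) head_sub_cone.
  move=> /(cone_coef_ge0 _ _ _ b0 (body_compl _ Sw)) ab.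
  have -> : a = 0 by lra.
  have -> : b = 0 by lra.
  by rewrite !scale0r addr0.
- move=> v; rewrite linear_spanE => -[c [b [w [_ b0 Sw ->]]]].
  (* [k >= - c] and [k >= c + b] suffice; [+ 1] makes [k] positive. *)
  exists (`|c| + b + 1); first by rewrite ltr_wpDl ?addr_ge0.
  have cn := ler_norm c; have cN := ler_norm (- c); rewrite normrN in cN.
  rewrite head_sub_cone addrA -scalerDl; split; apply: cone_head_body => //.
  + by lra.
  + by lra.
  + exact: body_compl.
- move=> v; rewrite linear_spanE => -[c [b [w [_ b0 Sw ->]]]] H.
  apply: cone_head_body => //; apply/ler_addgt0Pr => k k0.
  have := H k k0; rewrite addrA -scalerDl (addrC k).
  exact: cone_coef_ge0.
Qed.

Lemma skeleton_bodyE : S0 =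
  [set v | [/\ generated_cone S v,
               order_unit_norm (generated_cone S) e v = 1
             & order_unit_norm (generated_cone S) e (e - v) = 1]].
Proof.
have norm_scale b w : 0 <= b -> S0 w ->
    order_unit_norm (generated_cone S) e (b *: w) = b.
  move=> b0 Sw; have := order_unit_norm_cone 0 b w (lexx 0) b0 Sw.
  by rewrite scale0r !add0r.
have norm_body w : S0 w -> order_unit_norm (generated_cone S) e w = 1.
  by move=> Sw; rewrite -[w in LHS]scale1r norm_scale.
apply/seteqP; split => [v Sv | v []].
  split; [| exact: norm_body | exact/norm_body/body_compl].
  by have := cone_head_body 0 1 _ (lexx 0) ler01 Sv; rewrite scale0r add0r scale1r.
rewrite {1}generated_coneE => -[a [b [w [/= a0 b0 Sw ->]]]].
rewrite order_unit_norm_cone // -[X in X - _]scale1r head_sub_cone => ab.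
rewrite ab subrr scale0r add0r norm_scale //; last exact: body_compl.
move=> b1; have a00 : a = 0 by lra.
by rewrite a00 b1 scale0r add0r scale1r.
Qed.

End Skeleton.

Theorem theorem1p2 (R : realType) (X : lmodType R)
    (hX : exists x : X, x <> 0)
    (S : set X) (e : X) (hS : skeleton S e) :
  let V := linear_span S in
  let Vp := generated_cone S in
  order_unit_space V Vp e /\
  skeleton_body S e = [set v | [/\ Vp v, order_unit_norm Vp e v = 1
                        & order_unit_norm Vp e (e - v) = 1]].
Proof.
by split; [exact: order_unit_space_skeleton | exact: skeleton_bodyE].
Qed.
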